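(* Any randomized algorithm that (possibly adaptively) reads entries of a binary matrix $\mathbf A\in\{0,1\}^{n\times n}$ to construct a data structure $f:\mathbb{R}^n\times\mathbb{R}^n\to\mathbb{R}$ that, for $\epsilon\in(0,1)$, satisfies with probability at least $99/100$ $$|f(\mathbf x,\mathbf y)-\mathbf x^T\mathbf A\mathbf y|\le\epsilon n\quad\text{for all unit vectors }\mathbf x,\mathbf y\in\mathbb{R}^n,$$ must read $\Omega(n/\epsilon^2)$ entries of $\mathbf A$ in the worst case, provided $\epsilon=\Omega\!\left(\frac{\log n}{\sqrt n}\right)$.
   Formalization: The range ε∈(0,1) is replaced by 0<ε≤ε₀ for an arbitrary constant ε₀<1/2, with the Ω-constant depending on ε₀; for ε≥1/2 the claim is false, since f(x,y)=xᵀ(J/2)y (J all ones) reads no entry and has error at most n/2. *)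

(* Defs.v *)
From HB Require Import structures.
From mathcomp Require Import all_boot all_order all_algebra.
From mathcomp Require Import all_classical all_reals all_analysis.

Set Implicit Arguments.
Unset Strict Implicit.
Unset Printing Implicit Defensive.
Import Order.TTheory GRing.Theory Num.Theory.
Local Open Scope classical_set_scope.
Local Open Scope ring_scope.

(* Deterministic adaptive algorithms on an n x n binary matrix: the next entry
   to read depends on the bits read so far, and a result of type O is returned
   at the end.  A randomized algorithm is a family of such trees indexed by the
   outcomes of a probability space. *)
Inductive query_tree (n : nat) (O : Type) : Type :=
| Return of O
| Read of 'I_n & 'I_n & (bool -> query_tree n O).

Fixpoint output n O (t : query_tree n O) (A : 'M[bool]_n) : O :=
  match t with
  | Return o => o
  | Read i j k => output (k (A i j)) A
  end.

(* The set of positions read: rereading an entry is not counted twice. *)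
Fixpoint entries_read n O (t : query_tree n O) (A : 'M[bool]_n) :
    {set 'I_n * 'I_n} :=
  match t with
  | Return _ => finset.set0
  | Read i j k => ((i, j) |: entries_read (k (A i j)) A)%SET
  end.

Section Approximation.
Variables (R : realType) (n : nat).

(* The library's norm on matrices is the sup norm, hence this definition. *)
Definition l2norm (x : 'cV[R]_n) : R := Num.sqrt (\sum_i x i 0 ^+ 2).

Definition bilin (A : 'M[bool]_n) (x y : 'cV[R]_n) : R :=
  (x^T *m map_mx (fun b : bool => b%:R) A *m y) 0 0.

Definition approximates (eps : R) (A : 'M[bool]_n)
    (f : 'cV[R]_n -> 'cV[R]_n -> R) : Prop :=
  forall x y : 'cV[R]_n, l2norm x = 1 -> l2norm y = 1 ->
    `|f x y - bilin A x y| <= eps * n%:R.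

End Approximation.

(* S has inner probability at least p; this is p <= P S when S is measurable,
   and lets us avoid any measurability condition on randomized algorithms. *)
Definition with_probability_ge d (T : measurableType d) (R : realType)
    (P : probability T R) (p : R) (S : set T) : Prop :=
  exists E : set T, [/\ measurable E, E `<=` S & (p%:E <= P E)%E].

Section RandomizedAlgorithm.
Context d (T : measurableType d) (R : realType) (P : probability T R) (n : nat).
Variable alg : T -> query_tree n ('cV[R]_n -> 'cV[R]_n -> R).

Definition succeeds (eps : R) : Prop :=
  forall A : 'M[bool]_n,
    with_probability_ge P (99%:R / 100%:R)
      [set w | approximates eps A (output (alg w) A)].

(* Worst case over the matrix and over the random outcomes, the latter up to a
   null set. *)
Definition worst_case_reads_le (q : nat) : Prop :=
  forall A : 'M[bool]_n,
    {ae P, forall w, (#|entries_read (alg w) A| <= q)%N}.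

End RandomizedAlgorithm.

(* Main.v *)
(** Take [m] of order [1 / eps^2] and matrices whose columns are [m] arbitrary
    vectors of [{0,1}^n], each repeated about [n / m] times, so that one read
    reveals only one of the [n m] free bits.  Given the bits that a run reads,
    complementing all the others produces a matrix on which the run reads the
    same entries and returns the same [f].  If few bits are read, some column
    [k] is mostly complemented; with [x] the normalized signs of that column and
    [y] the normalized indicator of its copies, the two bilinear forms differ by
    more than [2 eps n], so [f] fails for one of the two matrices.  This pairing
    shows that no run succeeds on more than half of the matrices, and averaging
    contradicts the success probability [99/100].  For [eps0] close to [1/2] one
    still has [m >= 1] because [m] is the integer part of [(eps0 / eps)^2]. *)

Require Import Defs.
From HB Require Import structures.
From mathcomp Require Import all_boot all_order all_algebra.
From mathcomp Require Import all_classical all_reals all_analysis.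
From mathcomp Require Import measurable_realfun ring lra.
Set Implicit Arguments.
Unset Strict Implicit.
Unset Printing Implicit Defensive.
Import Order.TTheory GRing.Theory Num.Theory.
Local Open Scope ring_scope.

(** Induction on the tree: the first bit read agrees, so both runs take the same branch. *)
Lemma eq_on_entries_read (n : nat) (O : Type) (t : query_tree n O)
    (A B : 'M[bool]_n) :
  (forall i j, (i, j) \in entries_read t A -> B i j = A i j) ->
  output t B = output t A /\ entries_read t B = entries_read t A.
Proof.
elim: t => [//|i j k IH] /= AB.
have -> : B i j = A i j by apply: AB; rewrite in_setU1 eqxx.
have [|-> ->] := IH (A i j); last by [].
by move=> i' j' h; apply: AB; rewrite in_setU1 h orbT.
Qed.

Lemma bilinE (R : realType) (n : nat) (A : 'M[bool]_n) (x y : 'cV[R]_n) :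
  bilin A x y = \sum_i x i 0 * \sum_j (A i j)%:R * y j 0.
Proof.
rewrite /bilin -mulmxA mxE; apply: eq_bigr => i _; rewrite !mxE; congr (_ * _).
by apply: eq_bigr => j _; rewrite mxE.
Qed.

Section RepeatedColumns.
Context {R : realType} {n m : nat}.
Variable b : 'I_n -> 'I_m.

Definition repeat_columns (z : 'M[bool]_(n, m)) : 'M[bool]_n :=
  \matrix_(i, j) z i (b j).

(** Reading several copies of one column in the same row reveals a single bit, counted once here. *)
Definition bits_read (S : {set 'I_n * 'I_n}) : {set 'I_n * 'I_m} :=
  [set (p.1, b p.2) | p in S].

Definition flip_unread (S : {set 'I_n * 'I_n}) (z : 'M[bool]_(n, m)) :=
  \matrix_(i, k) (z i k (+) ((i, k) \notin bits_read S)).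

Lemma flip_unreadK (S : {set 'I_n * 'I_n}) : involutive (flip_unread S).
Proof. by move=> z; apply/matrixP => i k; rewrite !mxE addbK. Qed.

Lemma flip_unread_eq_on (S : {set 'I_n * 'I_n}) z i j : (i, j) \in S ->
  repeat_columns (flip_unread S z) i j = repeat_columns z i j.
Proof.
move=> ijS; rewrite !mxE (_ : (_, _) \in _) ?addbF//.
by apply/imsetP; exists (i, j).
Qed.

(** The at most [#|S|] bits read are split among [m] columns; a column with the fewest of them has
    at most the average. *)
Lemma exists_rarely_read_column (S : {set 'I_n * 'I_n}) : (0 < m)%N ->
  exists k : 'I_m, (m * #|[set i | (i, k) \in bits_read S]| <= #|S|)%N.
Proof.
move=> m_gt0; pose g (k : 'I_m) := #|[set i | (i, k) \in bits_read S]|.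
have [k _ kmin] := @arg_minnP _ (Ordinal m_gt0) xpredT g isT.
exists k; apply: leq_trans (leq_imset_card (fun p => (p.1, b p.2)) _).
rewrite -/(bits_read S) -[leqRHS]sum1_card (partition_big snd xpredT)//=.
rewrite -[m in (m * _)%N]card_ord -sum_nat_const leq_sum// => l _.
apply: leq_trans (kmin l isT) _.
rewrite sum1dep_card /g -(card_imset _ (_ : injective (fun i => (i, l)))); last first.
  by move=> ? ? [].
apply/subset_leq_card/fintype.subsetP => _ /imsetP[i il ->].
by rewrite !inE in il *; rewrite il eqxx.
Qed.

Lemma approximates_both_flips (S : {set 'I_n * 'I_n}) (z : 'M[bool]_(n, m))
    (k : 'I_m) (eps : R) f :
  (0 < n)%N -> (0 < #|[set j | b j == k]|)%N ->
  approximates eps (repeat_columns z) f ->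
  approximates eps (repeat_columns (flip_unread S z)) f ->
  #|[set i | (i, k) \notin bits_read S]|%:R *
    Num.sqrt #|[set j | b j == k]|%:R <= 2 * eps * n%:R * Num.sqrt n%:R.
Proof.
set U := [set i | _ \notin _]; set B := [set j | _].
move=> n_gt0 B_gt0 apz apz'.
have sn_gt0 : 0 < Num.sqrt n%:R :> R by rewrite sqrtr_gt0 ltr0n.
have sB_gt0 : 0 < Num.sqrt #|B|%:R :> R by rewrite sqrtr_gt0 ltr0n.
(* The sign is [+1] exactly where the bit is 1, so complementing any bit of column [k] lowers the
   form: the unread rows contribute without cancellation. *)
pose x : 'cV[R]_n := \col_i ((-1) ^+ (~~ z i k) / Num.sqrt n%:R).
pose y : 'cV[R]_n := \col_j ((j \in B)%:R / Num.sqrt #|B|%:R).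
have x1 : l2norm x = 1.
  rewrite /l2norm (eq_bigr (fun=> n%:R^-1)) => [|i _]; last first.
    by rewrite mxE expr_div_n sqrr_sign sqr_sqrtr ?ler0n// div1r.
  by rewrite sumr_const card_ord -[_ *+ n]mulr_natr mulVf ?sqrtr1// pnatr_eq0 -lt0n.
have y1 : l2norm y = 1.
  rewrite /l2norm (eq_bigr (fun j => (j \in B)%:R * #|B|%:R^-1)) => [|j _]; last first.
    by rewrite mxE expr_div_n sqr_sqrtr ?ler0n// -natrX; case: (_ \in _).
  rewrite -mulr_suml -natr_sum -big_mkcond/= sum1_card mulfV ?sqrtr1//.
  by rewrite pnatr_eq0 -lt0n.
have bilinB : bilin (repeat_columns z) x y -
    bilin (repeat_columns (flip_unread S z)) x y =
    #|U|%:R * Num.sqrt #|B|%:R / Num.sqrt n%:R.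
  rewrite !bilinE -sumrB -sum1_card natr_sum !mulr_suml [RHS]big_mkcond/=.
  apply: eq_bigr => i _; rewrite -mulrBr -sumrB.
  rewrite (eq_bigr (fun j => (j \in B)%:R *
      (((z i k)%:R - (flip_unread S z i k)%:R) / Num.sqrt #|B|%:R))); last first.
    move=> j _; rewrite -mulrBl !mxE inE.
    by case: eqP => [->|]; rewrite ?mul1r// !mul0r mulr0.
  rewrite -mulr_suml -natr_sum -big_mkcond/= sum1_card.
  rewrite !mxE inE -[X in X * (_ / _)](@sqr_sqrtr _ #|B|%:R) ?ler0n//.
  have sn_neq0 := lt0r_neq0 sn_gt0; have sB_neq0 := lt0r_neq0 sB_gt0.
  case: (_ \in bits_read S); case: (z i k) => /=; rewrite ?expr0 ?expr1;
    by field; rewrite ?sn_neq0 ?sB_neq0.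
(* Both forms are within [eps * n] of the same [f x y]. *)
have := ler_distD (f x y) (bilin (repeat_columns z) x y)
  (bilin (repeat_columns (flip_unread S z)) x y).
rewrite bilinB ger0_norm ?mulr_ge0 ?invr_ge0 ?ler0n ?sqrtr_ge0//.
rewrite [X in X + _]distrC => /le_trans /(_ (lerD (apz x y x1 y1) (apz' x y x1 y1))).
by rewrite ler_pdivrMr// -mulr2n -[_ *+ 2]mulr_natl !mulrA.
Qed.

End RepeatedColumns.

(** The sum of the [P (E i)] is the expected number of events [E i] containing [w], and this number
    is almost surely at most half of [#|I|]. *)
Lemma mean_card_le_half d (T : measurableType d) (R : realType)
    (P : probability T R) (I : finType) (E : I -> set T) (p : R) :
  (0 < #|I|)%N -> (forall i, measurable (E i)) ->
  (forall i, (p%:E <= P (E i))%E) ->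
  {ae P, forall w, (2 * #|[set i | w \in E i]| <= #|I|)%N} ->
  p <= 2^-1.
Proof.
move=> I_gt0 mE pE aeE.
have IR_gt0 : 0 < #|I|%:R :> R by rewrite ltr0n.
suff : ((\sum_(i : I) p)%:E <= (#|I|%:R / 2)%:E)%E.
  by rewrite lee_fin sumr_const -[_ *+ _]mulr_natl ler_pM2l.
rewrite -sumEFin; apply: (@le_trans _ _ (\sum_(i : I) P (E i))%E).
  by apply: lee_sum => i _; exact: pE.
have -> : (\sum_(i : I) P (E i) = \int[P]_w \sum_(i : I) (\1_(E i) w)%:E)%E.
  rewrite ge0_integral_sum//.
    by apply: eq_bigr => i _; rewrite integral_indic// setIT.
  by move=> i; apply/measurable_EFinP; exact: measurable_indic.
have -> : (#|I|%:R / 2)%:E = (\int[P]_w (#|I|%:R / 2)%:E)%E.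
  by rewrite integral_cst//= probability_setT mule1.
apply: ae_ge0_le_integral => //.
- by move=> w _; apply: sume_ge0 => i _; rewrite lee_fin.
- apply: emeasurable_sum => i.
  by apply/measurable_EFinP; exact: measurable_indic.
apply: filterS aeE => w card_le _.
rewrite sumEFin lee_fin ler_pdivlMr//.
rewrite (eq_bigr (fun i => (w \in E i)%:R)) => [|i _]; last by rewrite indicE.
rewrite -natr_sum -big_mkcond/= sum1dep_card -natrM ler_nat mulnC.
exact: card_le.
Qed.

Lemma reads_lower_bound (R : realType) d (T : measurableType d)
    (P : probability T R) (n m : nat) (b : 'I_n -> 'I_m)
    (alg : T -> query_tree n ('cV[R]_n -> 'cV[R]_n -> R)) (eps : R) (q t : nat) :
  (0 < n)%N -> (0 < m)%N -> (0 < t)%N ->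
  (forall k, t <= #|[set j | b j == k]|)%N ->
  succeeds P alg eps -> worst_case_reads_le P alg q ->
  (n%:R - q%:R / m%:R) * Num.sqrt t%:R <= 2 * eps * n%:R * Num.sqrt n%:R.
Proof.
move=> n_gt0 m_gt0 t_gt0 tB succ wc; rewrite leNgt; apply/negP => big.
(* [E z] is a measurable event inside the success event of [z], as averaging requires. *)
have [E EP] := choice (fun z => succ (repeat_columns b z)).
suff : (99%:R / 100%:R : R) <= 2^-1 by lra.
apply: (@mean_card_le_half _ _ _ P 'M[bool]_(n, m) E).
- by apply/card_gt0P; exists (\matrix_(i, j) false).
- by move=> z; case: (EP z).
- by move=> z; case: (EP z).
(* There are finitely many [z], so one null set serves for all of them. *)
have : {ae P, forall w z, (#|entries_read (alg w) (repeat_columns b z)| <= q)%N}.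
  by apply: filter_forall => z; exact: wc.
apply: filterS => w wq; set G := [set z | _].
pose S z := entries_read (alg w) (repeat_columns b z).
pose flip z := flip_unread b (S z) z.
have flip_same z := @eq_on_entries_read n _ (alg w) (repeat_columns b z)
  (repeat_columns b (flip z)) (fun i j h => @flip_unread_eq_on _ _ b _ z i j h).
(* The set of complemented bits depends on [z], but it is the same for [flip z], whose run reads the
   same entries. *)
have flipK : involutive flip.
  by move=> z; rewrite {1}/flip /S (flip_same z).2 flip_unreadK.
(* If [z] and [flip z] were both in [G], one output would approximate both forms, contradicting
   [big] on a rarely read column. *)
have disjG : [disjoint G & flip @: G].
  apply/pred0P => z' /=; apply/negP => /andP[+ /imsetP[z zG z'E]].
  rewrite {}z'E in zG *; rewrite !inE in zG * => z'G.
  have [_ /(_ w zG)/= apz _] := EP z.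
  have [_ /(_ w z'G)/= apz' _] := EP (flip z).
  rewrite (flip_same z).1 in apz'.
  have [k kq] := @exists_rarely_read_column _ _ b (S z) m_gt0.
  have B_gt0 := leq_trans t_gt0 (tB k).
  have := approximates_both_flips n_gt0 B_gt0 apz apz'.
  apply/negP; rewrite -ltNge; apply: (lt_le_trans big).
  rewrite -/(S z); set r := [set i | _] in kq; set U := [set i | _].
  have -> : U = ~: r by apply/setP => i; rewrite !inE.
  apply: (@le_trans _ _ (#|~: r|%:R * Num.sqrt t%:R)).
    apply: ler_wpM2r; first exact: sqrtr_ge0.
    have r_le : #|r|%:R <= q%:R / m%:R :> R.
      rewrite ler_pdivlMr ?ltr0n// -natrM ler_nat mulnC.
      exact: leq_trans kq (wq z).
    by rewrite -[n in leLHS]card_ord -(cardsC r) natrD; lra.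
  apply: ler_wpM2l; first exact: ler0n.
  by rewrite ler_wsqrtr// ler_nat.
rewrite mul2n -addnn -[X in (_ + X <= _)%N](card_imset _ (inv_inj flipK)).
have := (leq_card_setU G (flip @: G)).2; rewrite disjG => /eqP <-.
exact: max_card.
Qed.

(** The indices [r * m + k] with [r < n %/ m] lie below [n] and are congruent to [k] modulo [m]. *)
Lemma card_modn_fiber (n m : nat) (m_gt0 : (0 < m)%N) (k : 'I_m) :
  (n %/ m <= #|[set j : 'I_n | Ordinal (ltn_pmod j m_gt0) == k]|)%N.
Proof.
have lt_n (r : 'I_(n %/ m)) : (r * m + k < n)%N.
  apply: leq_trans (leq_divM n m); apply: (@leq_trans (r.+1 * m)).
    by rewrite mulSn addnC ltn_add2r.
  by rewrite leq_mul2r ltn_ord orbT.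
rewrite -[leqLHS]card_ord -(card_imset _ (_ : injective (fun r => Ordinal (lt_n r)))).
  apply/subset_leq_card/fintype.subsetP => _ /imsetP[r _ ->].
  by rewrite inE -val_eqE/= modnMDl modn_small.
move=> r s [] /addIn/eqP; rewrite eqn_pmul2r// => /eqP; exact: val_inj.
Qed.

Unset Implicit Arguments.

Theorem theorem11 (R : realType) (C eps0 : R) (C_gt0 : 0 < C)
    (eps0_lt_half : eps0 < 2^-1) :
  exists2 c : R, 0 < c &
  exists N : nat, forall (n : nat) (eps : R),
    (N <= n)%N -> 0 < eps -> eps <= eps0 ->
    C * (ln n%:R / Num.sqrt n%:R) <= eps ->
    forall (d : measure_display) (T : measurableType d) (P : probability T R)
      (alg : T -> query_tree n ('cV[R]_n -> 'cV[R]_n -> R)) (q : nat),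
      succeeds P alg eps ->
      worst_case_reads_le P alg q ->
      c * (n%:R / eps ^+ 2) <= q%:R.
Proof.
have [eps0_le0|a_gt0] := leP eps0 0.
  exists 1 => //; exists 0%N => n eps _ eps_gt0 eps_le.
  by have := lt_le_trans eps_gt0 (le_trans eps_le eps0_le0); rewrite ltxx.
set a := eps0 in a_gt0 *.
(* The slack left by [a < 1/2]. The final inequality is [4 a^2 = 1 - 4 delta < (1 - delta)^3]: two
   factors [1 - delta] come from squaring the unread fraction, one from rounding [n / m]. *)
pose delta : R := (1 - 4 * a ^+ 2) / 4.
have a2_gt0 : 0 < a ^+ 2 by rewrite exprn_gt0.
have a2_lt : a ^+ 2 < 4^-1.
  have -> : 4^-1 = 2^-1 ^+ 2 :> R by field.
  by rewrite ltrXn2r// ltW.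
have a2E : 4 * a ^+ 2 = 1 - 4 * delta by rewrite /delta; field.
clearbody delta.
have delta_gt0 : 0 < delta by lra.
have delta_lt1 : delta < 1 by lra.
(* A lower bound for [ln n], chosen so that [a^2 / delta = C^2 (L - 1) <= (C L)^2]. *)
pose L : R := 1 + a ^+ 2 / (delta * C ^+ 2).
have L_ge1 : 1 <= L.
  by rewrite lerDl divr_ge0 ?sqr_ge0// mulr_ge0 ?sqr_ge0// ltW.
(* The factor [1/2] pays for rounding [r] down to [m >= r / 2]. *)
exists (delta * a ^+ 2 / 2); first by rewrite !mulr_gt0.
exists (Num.truncn (expR L)).+1 => n eps Nn eps_gt0 eps_le lnle d T P alg q succ wc.
rewrite leNgt; apply/negP => q_small.
have n_gt0 : (0 < n)%N by apply: leq_trans Nn.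
have nR_gt0 : 0 < n%:R :> R by rewrite ltr0n.
have lnn : L <= ln n%:R.
  rewrite -[L]expRK ler_ln ?posrE ?expR_gt0// ltW//.
  by apply: (lt_le_trans (truncnS_gt _)); rewrite ler_nat.
have e2_gt0 : 0 < eps ^+ 2 by rewrite exprn_gt0.
(* That is, [a^2 / eps^2 <= delta n], so that rounding [n / m] down loses at most a fraction [delta]
   of it. *)
have n_large : a ^+ 2 <= delta * eps ^+ 2 * n%:R.
  have Cln : C * L <= eps * Num.sqrt n%:R.
    rewrite -ler_pdivrMr ?sqrtr_gt0//; apply: le_trans lnle.
    by rewrite mulrA ler_pM2r ?invr_gt0 ?sqrtr_gt0// ler_pM2l.
  have : (C * L) ^+ 2 <= eps ^+ 2 * n%:R.
    rewrite -[n%:R in leRHS](@sqr_sqrtr _ n%:R) ?ler0n// -exprMn.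
    by rewrite lerXn2r// nnegrE mulr_ge0 ?sqrtr_ge0 ?ltW// (lt_le_trans ltr01).
  move=> CL; rewrite -mulrA -ler_pdivrMl//; apply: le_trans CL.
  have -> : delta^-1 * a ^+ 2 = C ^+ 2 * (L - 1).
    by rewrite /L; field; rewrite !lt0r_neq0.
  by rewrite exprMn ler_pM2l ?exprn_gt0//; nra.
pose r : R := a ^+ 2 / eps ^+ 2.
have r_ge1 : 1 <= r by rewrite ler_pdivlMr// mul1r lerXn2r// nnegrE ltW.
pose m := Num.truncn r.
have /andP[m_le lt_mS] : m%:R <= r < m.+1%:R by apply: truncn_itv; apply: le_trans r_ge1.
have m_gt0 : (0 < m)%N by rewrite truncn_gt0.
have mR_gt0 : 0 < m%:R :> R by rewrite ltr0n.
have mR_ge1 : 1 <= m%:R :> R by rewrite ler1n.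
have r_le : r <= 2 * m%:R by rewrite -natr1 in lt_mS; lra.
have q_le : q%:R / m%:R <= delta * n%:R.
  rewrite ler_pdivrMr//; apply: le_trans (ltW q_small) _.
  have -> : delta * a ^+ 2 / 2 * (n%:R / eps ^+ 2) = delta * n%:R * (r / 2).
    by rewrite /r; field; rewrite lt0r_neq0.
  by rewrite ler_pM2l ?mulr_gt0//; lra.
pose t := (n %/ m)%N.
have t_ge : (1 - delta) * eps ^+ 2 * n%:R <= a ^+ 2 * t%:R.
  have /ltW : n%:R < (t%:R + 1) * m%:R :> R by rewrite natr1 -natrM ltr_nat ltn_ceil.
  have m_le' : m%:R * eps ^+ 2 <= a ^+ 2 by rewrite -ler_pdivlMr.
  have t_ge0 : 0 <= t%:R :> R by rewrite ler0n.
  rewrite -(ler_pM2r e2_gt0) => nt.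
  have : (t%:R + 1) * m%:R * eps ^+ 2 <= (t%:R + 1) * a ^+ 2.
    by rewrite -mulrA ler_wpM2l// addr_ge0.
  by lra.
have t_gt0 : (0 < t)%N.
  rewrite -(@ltr0n R) -(pmulr_rgt0 _ a2_gt0); apply: lt_le_trans t_ge.
  by rewrite !mulr_gt0// subr_gt0.
have := reads_lower_bound n_gt0 m_gt0 t_gt0 (card_modn_fiber n m_gt0) succ wc.
apply/negP; rewrite -ltNge.
apply: (@lt_le_trans _ _ (n%:R * ((1 - delta) * Num.sqrt t%:R))); last first.
  by rewrite mulrA ler_wpM2r ?sqrtr_ge0// mulrBr mulr1 [n%:R * delta]mulrC; lra.
rewrite mulrAC mulrC ltr_pM2l//.
(* Squaring removes the roots; multiplying by [a^2] then allows [t_ge] to replace [t] by a multiple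
   of [eps^2 n]. *)
rewrite -(@ltr_pXn2r _ 2)// ?nnegrE ?mulr_ge0 ?sqrtr_ge0 ?subr_ge0 ?ltW//.
rewrite !exprMn !sqr_sqrtr ?ler0n// -(ltr_pM2l a2_gt0).
have : (1 - delta) ^+ 3 * eps ^+ 2 * n%:R <= a ^+ 2 * ((1 - delta) ^+ 2 * t%:R).
  have -> : (1 - delta) ^+ 3 * eps ^+ 2 * n%:R =
    (1 - delta) ^+ 2 * ((1 - delta) * eps ^+ 2 * n%:R) by ring.
  by rewrite [leRHS]mulrCA ler_pM2l// exprn_gt0// subr_gt0.
apply: lt_le_trans.
have -> : a ^+ 2 * (2 ^+ 2 * eps ^+ 2 * n%:R) = (1 - 4 * delta) * eps ^+ 2 * n%:R.
  by rewrite -a2E; ring.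
rewrite !ltr_pM2r//.
have : 0 < delta * (1 - delta) by rewrite mulr_gt0// subr_gt0.
by nra.
Qed.
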